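(* Let $K$ be an uncountable subfield of $\mathbb{R}$ and let $\mathcal{R}$ be an expansion of $\mathcal{M}_K$. Then the following are equivalent: (1) $\mathcal{R}$ does not define a dense $\omega$-orderable set. (2) $\mathcal{R}$ avoids a compact set.
   Context: For a subfield $K$ of $\mathbb{R}$, $\mathcal{M}_K$ is the first-order structure expanding $(\mathbb{R},<,+)$ by all functions $\mathbb{R} \to \mathbb{R}$, $x \mapsto \lambda x$, for $\lambda \in K$. An expansion of a structure has the same underlying set $\mathbb{R}$ and possibly more primitive relations and functions. ''Definable'' means first-order definable in $\mathcal{R}$, with parameters allowed. A definable subset of $\mathbb{R}^n$ is $\omega$-orderable if it is either finite or admits a definable ordering with order type $\omega$. $\mathcal{R}$ defines a dense $\omega$-orderable set if it defines an $\omega$-orderable subset of $\mathbb{R}$ that is dense in some nonempty open interval. $\mathcal{R}$ avoids a compact set if for some $n$ there is a compact subset of $\mathbb{R}^n$ that is not definable in $\mathcal{R}$. *)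

(* Defs.v *)
From HB Require Import structures.
From mathcomp Require Import all_boot all_order all_algebra.
From mathcomp Require Import all_classical all_reals all_analysis.
Import Order.TTheory GRing.Theory Num.Theory.
Import numFieldNormedType.Exports.

Set Implicit Arguments.
Unset Strict Implicit.
Unset Printing Implicit Defensive.

Local Open Scope classical_set_scope.
Local Open Scope ring_scope.

(* The symbols of each arity are bundled with their interpretations; points of
   the n-th cartesian power of T are row vectors. *)
Record structure (T : Type) := Structure {
  fun_symb : nat -> Type;
  rel_symb : nat -> Type;
  fun_interp : forall n, fun_symb n -> 'rV[T]_n -> T;
  rel_interp : forall n, rel_symb n -> set 'rV[T]_n }.

(* N expands M. *)
Definition expansion_of (T : Type) (M N : structure T) : Prop :=
  exists (F : forall n, fun_symb M n -> fun_symb N n)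
         (P : forall n, rel_symb M n -> rel_symb N n),
    [/\ forall n, injective (F n),
        forall n, injective (P n),
        forall n (f : fun_symb M n), fun_interp (F n f) = fun_interp f &
        forall n (r : rel_symb M n), rel_interp (P n r) = rel_interp r].

Inductive term (T : Type) (M : structure T) (n : nat) : Type :=
| Var of 'I_n
| App k of fun_symb M k & ('I_k -> term M n).

(* [formula M n] has its free variables among 'I_n; a quantifier binds
   variable 0 and shifts the others, de Bruijn style. *)
Inductive formula (T : Type) (M : structure T) : nat -> Type :=
| Equal n of term M n & term M n : formula M n
| Rel n k of rel_symb M k & ('I_k -> term M n) : formula M n
| Not n of formula M n : formula M n
| And n of formula M n & formula M n : formula M n
| Exists n of formula M n.+1 : formula M n.

Fixpoint eval (T : Type) (M : structure T) (n : nat) (v : 'rV[T]_n)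
    (t : term M n) : T :=
  match t with
  | Var i => v ord0 i
  | App _ f ts => fun_interp f (\row_i eval v (ts i))
  end.

Fixpoint holds (T : Type) (M : structure T) (n : nat) (phi : formula M n) :
    'rV[T]_n -> Prop :=
  match phi in formula _ n return 'rV[T]_n -> Prop with
  | Equal _ s t => fun v => eval v s = eval v t
  | Rel _ _ r ts => fun v => rel_interp r (\row_i eval v (ts i))
  | Not _ psi => fun v => ~ holds psi v
  | And _ psi chi => fun v => holds psi v /\ holds chi v
  | Exists n psi => fun v =>
      exists x : T, holds psi (row_mx (const_mx x : 'rV[T]_1) v)
  end.

(* Definability with parameters, the parameters being the entries of b. *)
Definition definable (T : Type) (M : structure T) (n : nat)
    (A : set 'rV[T]_n) : Prop :=
  exists (m : nat) (phi : formula M (n + m)) (b : 'rV[T]_m),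
    A = [set a | holds phi (row_mx a b)].

Definition has_order_type_omega (U : Type) (A : set U) (lt : U -> U -> Prop) :
    Prop :=
  exists f : nat -> U,
    set_bij [set: nat] A f /\ forall i j, lt (f i) (f j) <-> (i < j)%N.

(* Only the restriction of lt to A matters, so only that graph has to be
   definable. *)
Definition omega_orderable (T : Type) (M : structure T) (n : nat)
    (A : set 'rV[T]_n) : Prop :=
  definable M A /\
  (finite_set A \/
   exists lt : 'rV[T]_n -> 'rV[T]_n -> Prop,
     definable M [set w : 'rV[T]_(n + n) |
       [/\ A (lsubmx w), A (rsubmx w) & lt (lsubmx w) (rsubmx w)]] /\
     has_order_type_omega A lt).

Definition dense_in_interval (R : realType) (D : set R) : Prop :=
  exists I : set R,
    [/\ is_interval I, open I, I !=set0 & I `<=` closure (D `&` I)].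

Definition defines_dense_omega_orderable (R : realType) (M : structure R) :
    Prop :=
  exists D : set R,
    omega_orderable M [set v : 'rV[R]_1 | D (v ord0 ord0)] /\
    dense_in_interval D.

Definition avoids_compact (R : realType) (M : structure R) : Prop :=
  exists (n : nat) (A : set 'rV[R]_n), compact A /\ ~ definable M A.

Variant ovs_fun (R : realType) (K : {pred R}) : nat -> Type :=
| AddSymb : ovs_fun K 2
| ScaleSymb (c : R) of c \in K : ovs_fun K 1.

Variant ovs_rel : nat -> Type := LtSymb : ovs_rel 2.

Definition ovs_fun_interp (R : realType) (K : {pred R}) (n : nat)
    (f : ovs_fun K n) : 'rV[R]_n -> R :=
  match f in ovs_fun _ n return 'rV[R]_n -> R with
  | AddSymb => fun v => v ord0 ord0 + v ord0 ord_max
  | ScaleSymb c _ => fun v => c * v ord0 ord0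
  end.

Definition ovs_rel_interp (R : realType) (n : nat) (r : ovs_rel n) :
    set 'rV[R]_n :=
  match r in ovs_rel n return set 'rV[R]_n with
  | LtSymb => [set v | v ord0 ord0 < v ord0 ord_max]
  end.

Definition ordered_vector_space (R : realType) (K : {pred R}) : structure R :=
  {| fun_symb := ovs_fun K;
     rel_symb := ovs_rel;
     fun_interp := @ovs_fun_interp R K;
     rel_interp := @ovs_rel_interp R |}.

(* Main.v *)
Require Import Defs.
From HB Require Import structures.
From mathcomp Require Import all_boot all_order all_algebra.
From mathcomp Require Import lra.
From mathcomp Require Import all_classical all_reals all_analysis.
Import Order.TTheory GRing.Theory Num.Theory.
Import numFieldNormedType.Exports.
Local Open Scope classical_set_scope.
Local Open Scope ring_scope.

Set Implicit Arguments.
Unset Strict Implicit.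
Unset Printing Implicit Defensive.

(** If every compact set is definable, take a sequence [q] of distinct reals that
    is dense in the unit interval.  The closure of the set of points
    (1/(n+1), q n) is compact, and its part with positive first coordinate is
    just that set of points ([closure_flag_pos]), so the structure defines both
    the range of [q] and the order of enumeration on it.

    Conversely, let [f] enumerate, along a definable ordering of type omega, a
    set D that is dense in an interval.  A compact set is the complement, in a
    large cube, of a union of balls whose centre and radius are coordinates of
    tuples of D; so it suffices to define arbitrary sets X of tuples of D
    ([definable_subset]).  Here the uncountability of K enters: D being
    countable, some scalar l in K is a root of no nonzero polynomial of degree at most k
    whose coefficients are differences of elements of D ([generic_scalar]), so the
    definable map (x, y) |-> x + sum_i l^(i+1) y_i is injective on D^(1+k).
    The image of D x {y} is a translate of D; thus a dense countable set of reals
    is cut definably into pieces, one for each tuple y, each of which is dense in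
    one common interval ([combination_dense]).

    Two real parameters now encode X ([coding]).  Call stage t the finite set of
    the values of the map at tuples over {f 0, ..., f t}.  Each stage t picks out
    the best approximation of a real c from below among its elements.  By density
    c can be steered, stage after stage, so that at a sparse sequence of stages
    this approximation lies in pieces that run through X in any prescribed order;
    at the stages in between nothing is controlled.  A second real d, approximated
    from below by D itself, records which stages count: those t for which f t is
    a best approximation of d so far.  Since an approximation can be followed by
    one that comes as late as desired, d and c can be built together. *)

(** * Definability in terms of environments *)

Definition rename_lift (m n : nat) (s : 'I_m -> 'I_n) (i : 'I_m.+1) : 'I_n.+1 :=
  if unlift ord0 i is Some j then lift ord0 (s j) else ord0.

Fixpoint rename_term (T : Type) (M : structure T) (m n : nat)
    (s : 'I_m -> 'I_n) (t : term M m) : term M n :=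
  match t with
  | Var i => Var M (s i)
  | App _ f ts => App f (fun i => rename_term s (ts i))
  end.

Fixpoint rename (T : Type) (M : structure T) (m : nat) (phi : formula M m) :
    forall n : nat, ('I_m -> 'I_n) -> formula M n :=
  match phi in formula _ m return forall n, ('I_m -> 'I_n) -> formula M n with
  | Equal _ t u => fun n s => Equal (rename_term s t) (rename_term s u)
  | Rel _ _ r ts => fun n s => Rel r (fun i => rename_term s (ts i))
  | Not _ psi => fun n s => Not (rename psi s)
  | And _ psi chi => fun n s => And (rename psi s) (rename chi s)
  | Exists _ psi => fun n s => Exists (rename psi (rename_lift s))
  end.

(** The environment of the body of a quantifier, entrywise: variable 0 is the
    bound one. *)
Lemma row_consE (T : Type) (n : nat) (x : T) (v : 'rV[T]_n) (i : 'I_n.+1) :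
  row_mx (const_mx x : 'rV[T]_1) v ord0 i =
  if unlift ord0 i is Some j then v ord0 j else x.
Proof.
case: unliftP => [j ->|->].
  by rewrite (_ : lift ord0 j = rshift 1 j) ?row_mxEr//; apply: val_inj.
rewrite (_ : ord0 = lshift n (ord0 : 'I_1)); last exact: val_inj.
by rewrite (row_mxEl (const_mx x)) mxE.
Qed.

Lemma eval_rename_term (T : Type) (M : structure T) (m n : nat)
    (s : 'I_m -> 'I_n) (t : term M m) (v : 'rV[T]_n) :
  Defs.eval v (rename_term s t) = Defs.eval (\row_i v ord0 (s i)) t.
Proof.
elim: t => [i|k f ts IH] /=; first by rewrite mxE.
by congr fun_interp; apply/rowP => i; rewrite !mxE IH.
Qed.

Lemma holds_rename (T : Type) (M : structure T) (m : nat) (phi : formula M m)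
    (n : nat) (s : 'I_m -> 'I_n) (v : 'rV[T]_n) :
  holds (rename phi s) v <-> holds phi (\row_i v ord0 (s i)).
Proof.
elim: phi n s v => {m} [m t u|m k r ts|m psi IH|m psi IHpsi chi IHchi|m psi IH]
  n s v /=.
- by rewrite !eval_rename_term.
- rewrite (_ : (\row_i _) = \row_i Defs.eval (\row_i v ord0 (s i)) (ts i)) //.
  by apply/rowP => i; rewrite !mxE eval_rename_term.
- by rewrite IH.
- by rewrite IHpsi IHchi.
- have E x : (\row_i row_mx (const_mx x : 'rV[T]_1) v ord0 (rename_lift s i)) =
             row_mx (const_mx x : 'rV[T]_1) (\row_i v ord0 (s i)).
    apply/rowP => i; rewrite mxE !row_consE /rename_lift.
    by case: (unliftP ord0 i) => [j _|_]; rewrite ?liftK ?unlift_none ?mxE.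
  by split=> -[x]; [rewrite IH E|rewrite -E -IH] => h; exists x.
Qed.

(** A free variable of a formula is either read off an infinite environment or
    replaced by a parameter. *)
Definition env_at (T : Type) (v : nat -> T) (s : nat + T) : T :=
  match s with inl k => v k | inr c => c end.

(** Definability with parameters for conditions on infinite environments, of
    which a formula sees only finitely many entries.  This avoids dependent
    arities: predicates that involve different variables can be combined as they
    stand, and substituting variables or parameters only changes the assignment
    of the free variables. *)
Definition definable_env (T : Type) (M : structure T) (P : (nat -> T) -> Prop) :
    Prop :=
  exists (n : nat) (phi : formula M n) (s : 'I_n -> nat + T),
    forall v, P v <-> holds phi (\row_i env_at v (s i)).

Lemma definable_env_ext (T : Type) (M : structure T) (P Q : (nat -> T) -> Prop) :
  (forall v, P v <-> Q v) -> definable_env M P -> definable_env M Q.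
Proof. by move=> PQ [n [phi [s h]]]; exists n, phi, s => v; rewrite -PQ. Qed.

Lemma definable_env_rename (T : Type) (M : structure T) (s : nat -> nat + T)
    (P : (nat -> T) -> Prop) :
  definable_env M P -> definable_env M (fun v => P (fun i => env_at v (s i))).
Proof.
move=> [n [phi [r h]]].
exists n, phi, (fun i => match r i with inl k => s k | inr c => inr c end) => v.
rewrite h; set u := (\row_i _); set w := (\row_i _).
suff -> : u = w by [].
by apply/rowP => i; rewrite !mxE; case: (r i).
Qed.

Lemma definable_env_not (T : Type) (M : structure T) (P : (nat -> T) -> Prop) :
  definable_env M P -> definable_env M (fun v => ~ P v).
Proof. by move=> [n [phi [s h]]]; exists n, (Not phi), s => v /=; rewrite h. Qed.

Lemma definable_env_and (T : Type) (M : structure T) (P Q : (nat -> T) -> Prop) :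
  definable_env M P -> definable_env M Q ->
  definable_env M (fun v => P v /\ Q v).
Proof.
move=> [m [phi [s hP]]] [n [psi [r hQ]]].
exists (m + n)%N, (And (rename phi (lshift n)) (rename psi (@rshift m n))),
  (fun i => match fintype.split i with inl j => s j | inr k => r k end) => v /=.
rewrite !holds_rename hP hQ.
set a := (\row_i _); set b := (\row_i _); set c := (\row_i _);
  set d := (\row_i _).
have -> : c = a by apply/rowP => i; rewrite !mxE -/(unsplit (inl i)) unsplitK.
by have -> : d = b by apply/rowP => i; rewrite !mxE -/(unsplit (inr i)) unsplitK.
Qed.

Definition scons (T : Type) (x : T) (v : nat -> T) (i : nat) : T :=
  if i is k.+1 then v k else x.

(** The free variables assigned to entry 0 of the extended environment become
    the bound variable; the others move down by one. *)
Lemma definable_env_scons (T : Type) (M : structure T) (P : (nat -> T) -> Prop) :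
  definable_env M P -> definable_env M (fun v => exists x, P (scons x v)).
Proof.
move=> [n [phi [s h]]].
pose f i := if s i is inl 0%N then ord0 else lift ord0 i.
pose r i := match s i with inl k => inl k.-1 | inr c => inr c end.
exists n, (Exists (rename phi f)), r => v /=.
have E x : (\row_i row_mx (const_mx x : 'rV[T]_1) (\row_i env_at v (r i)) ord0 (f i))
    = (\row_i env_at (scons x v) (s i)).
  apply/rowP => i; rewrite mxE row_consE [RHS]mxE /f /r.
  by case sE: (s i) => [[|k]|c]; rewrite ?unlift_none ?liftK ?mxE ?sE.
by split=> -[x hx]; exists x; move: hx; rewrite holds_rename E h.
Qed.

(** The form in which quantifiers are removed from a goal: the bound variable
    becomes entry 0 of the environment and the other entries move up. *)
Lemma definable_env_ex (T : Type) (M : structure T) (Q : T -> (nat -> T) -> Prop) :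
  definable_env M (fun v => Q (v 0%N) (fun i => v i.+1)) ->
  definable_env M (fun v => exists x, Q x v).
Proof. by move=> /definable_env_scons. Qed.

Lemma definable_env_true (T : Type) (M : structure T) :
  definable_env M (fun _ => True).
Proof.
exists 1%N, (Equal (Var M ord0) (Var M ord0)), (fun=> inl 0%N).
by move=> v.
Qed.

Lemma definable_env_imply (T : Type) (M : structure T) (P Q : (nat -> T) -> Prop) :
  definable_env M P -> definable_env M Q ->
  definable_env M (fun v => P v -> Q v).
Proof.
move=> dP dQ; apply: (@definable_env_ext _ _ (fun v => ~ (P v /\ ~ Q v))).
  move=> v; split=> [h p|h [p q]]; last exact: q (h p).
  by apply: contrapT => q; apply: h.
by apply/definable_env_not/definable_env_and/definable_env_not.
Qed.

Lemma definable_env_all (T : Type) (M : structure T) (Q : T -> (nat -> T) -> Prop) :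
  definable_env M (fun v => Q (v 0%N) (fun i => v i.+1)) ->
  definable_env M (fun v => forall x, Q x v).
Proof.
move=> dQ; apply: (@definable_env_ext _ _ (fun v => ~ exists x, ~ Q x v)).
  move=> v; split=> [h x|h [x nq]]; last exact: nq.
  by apply: contrapT => nq; apply: h; exists x.
by apply/definable_env_not/definable_env_ex/definable_env_not.
Qed.

Lemma definable_env_forall_ord (T : Type) (M : structure T) (n : nat)
    (P : 'I_n -> (nat -> T) -> Prop) :
  (forall i, definable_env M (P i)) ->
  definable_env M (fun v => forall i, P i v).
Proof.
elim: n P => [|n IH] P dP.
  apply: (definable_env_ext _ (definable_env_true M)) => v.
  by split=> // _ [].
apply: (@definable_env_ext _ _
    (fun v => P ord0 v /\ forall i, P (lift ord0 i) v)); last first.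
  by apply: definable_env_and => //; apply: IH.
move=> v; split=> [[p0 p] i|h]; last by split.
by case: (unliftP ord0 i) => [j|] ->.
Qed.

(** Iterated existential quantification, before the bound variables are gathered
    into a row vector. *)
Lemma definable_env_prefix (T : Type) (M : structure T) (n : nat)
    (P : (nat -> T) -> Prop) :
  definable_env M P ->
  definable_env M (fun v => exists w : nat -> T,
    P (fun i => if (i < n)%N then w i else v (i - n)%N)).
Proof.
elim: n P => [|n IH] P dP.
  apply: (definable_env_ext _ dP) => v.
  have E (w : nat -> T) :
      (fun i : nat => if (i < 0)%N then w i else v (i - 0)%N) = v.
    by apply/funext => i; rewrite subn0.
  by split=> [h|[w]]; [exists v|]; rewrite E.
apply: (definable_env_ext _ (IH _ (definable_env_scons dP))) => v.
have E (x : T) (w : nat -> T) :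
    scons x (fun i => if (i < n)%N then w i else v (i - n)%N) =
    (fun i => if (i < n.+1)%N then scons x w i else v (i - n.+1)%N).
  by apply/funext; case.
split=> [[w [x]]|[w]]; first by rewrite E; exists (scons x w).
move=> h; exists (fun i => w i.+1), (w 0%N); rewrite E.
by have -> : scons (w 0%N) (fun i => w i.+1) = w by apply/funext; case.
Qed.

Lemma definable_env_ex_row (T : Type) (M : structure T) (n : nat)
    (Q : 'rV[T]_n -> (nat -> T) -> Prop) :
  definable_env M (fun v => Q (\row_(i < n) v i) (fun i => v (n + i)%N)) ->
  definable_env M (fun v => exists z, Q z v).
Proof.
move=> /(definable_env_prefix n); apply: definable_env_ext => v.
have E (w : nat -> T) : (fun i => if (n + i < n)%N then w (n + i)%N
    else v (n + i - n)%N) = v.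
  by apply/funext => i; rewrite ltnNge leq_addr addKn.
split=> [[w]|[z h]] /=; rewrite ?E; first by eexists; eassumption.
pose w i := if insub i is Some j then z ord0 j else v i.
exists w => /=; rewrite E.
rewrite (_ : (\row_(i < n) _) = z)//; apply/rowP => i.
by rewrite mxE ltn_ord /w valK.
Qed.

Lemma definable_env_all_row (T : Type) (M : structure T) (n : nat)
    (Q : 'rV[T]_n -> (nat -> T) -> Prop) :
  definable_env M (fun v => Q (\row_(i < n) v i) (fun i => v (n + i)%N)) ->
  definable_env M (fun v => forall z, Q z v).
Proof.
move=> dQ; apply: (@definable_env_ext _ _ (fun v => ~ exists z, ~ Q z v)).
  move=> v; split=> [h x|h [x nq]]; last exact: nq.
  by apply: contrapT => nq; apply: h; exists x.
by apply/definable_env_not/definable_env_ex_row/definable_env_not.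
Qed.

(** Passage from definable sets to environments; [definable_of_env] goes back. *)
Lemma definable_env_row (T : Type) (M : structure T) (n : nat) (A : set 'rV[T]_n)
    (s : 'I_n -> nat) :
  definable M A -> definable_env M (fun v => A (\row_i v (s i))).
Proof.
move=> [m [phi [b ->]]]; exists (n + m)%N, phi,
  (fun i => match fintype.split i with inl j => inl (s j) | inr j => inr (b ord0 j) end).
move=> v /=; rewrite (_ : row_mx _ _ = \row_i env_at v
   match fintype.split i with inl j => inl (s j) | inr j => inr (b ord0 j) end) //.
by apply/rowP => i; rewrite !mxE; case: fintype.split => j; rewrite ?mxE.
Qed.

Lemma definable_of_env (T : Type) (M : structure T) (n : nat) (A : set 'rV[T]_n)
    (x0 : T) :
  definable_env M (fun v => A (\row_(i < n) v i)) -> definable M A.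
Proof.
(* A variable beyond the n-th may be assigned any value, so it is turned into a
   parameter with value x0. *)
move=> [m [phi [s h]]].
pose f (i : 'I_m) : 'I_(n + m) :=
  if s i is inl k then if insub k is Some j then lshift m j else rshift n i
  else rshift n i.
pose b : 'rV[T]_m := \row_i if s i is inr c then c else x0.
pose v (a : 'rV[T]_n) k := if insub k is Some j then a ord0 j else x0.
have va a : \row_(i < n) v a i = a by apply/rowP => i; rewrite mxE /v valK.
have E a : \row_i row_mx a b ord0 (f i) = \row_i env_at (v a) (s i).
  apply/rowP => i; rewrite mxE [RHS]mxE /f.
  case sE: (s i) => [k|c] /=; last by rewrite row_mxEr mxE sE.
  rewrite /v; case: (insub k) => [j|]; first by rewrite row_mxEl.
  by rewrite row_mxEr mxE sE.
exists m, (rename phi f), b; apply/seteqP; split => a /=.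
  by rewrite holds_rename E -h va.
by rewrite holds_rename E -h va.
Qed.

(** Terms are treated through their graphs, with the value in entry 0: a
    substitution then reduces to an existential quantifier. *)
Definition definable_fun (T : Type) (M : structure T) (t : (nat -> T) -> T) :
    Prop :=
  definable_env M (fun v => v 0%N = t (fun i => v i.+1)).

Lemma definable_env_subst (T : Type) (M : structure T) (t : (nat -> T) -> T)
    (Q : T -> (nat -> T) -> Prop) :
  definable_fun M t ->
  definable_env M (fun v => Q (v 0%N) (fun i => v i.+1)) ->
  definable_env M (fun v => Q (t v) v).
Proof.
move=> dt dQ.
apply: (@definable_env_ext _ _ (fun v => exists x, x = t v /\ Q x v)).
  by move=> v; split=> [[_ [->]]//|q]; exists (t v).
by apply: definable_env_ex; apply: definable_env_and.
Qed.

Lemma definable_fun_shift (T : Type) (M : structure T) (t : (nat -> T) -> T) :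
  definable_fun M t -> definable_fun M (fun v => t (fun i => v i.+1)).
Proof.
exact: (@definable_env_rename _ _ (fun i => inl (if i is k.+1 then k.+2 else 0%N))
  (fun v => v 0%N = t (fun i => v i.+1))).
Qed.

Lemma definable_env_subst2 (T : Type) (M : structure T) (s t : (nat -> T) -> T)
    (Q : T -> T -> (nat -> T) -> Prop) :
  definable_fun M s -> definable_fun M t ->
  definable_env M (fun v => Q (v 0%N) (v 1%N) (fun i => v i.+2)) ->
  definable_env M (fun v => Q (s v) (t v) v).
Proof.
move=> ds dt dQ.
apply: (definable_env_subst (Q := fun y v => Q (s v) y v) dt).
apply: (definable_env_subst (Q := fun x v => Q x (v 0%N) (fun i => v i.+1))).
  exact: definable_fun_shift.
exact: dQ.
Qed.

Lemma definable_fun_var (T : Type) (M : structure T) (k : nat) :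
  definable_fun M (fun v => v k).
Proof.
exists 2%N, (Equal (Var M ord0) (Var M ord_max)),
  (fun i => inl (if i == ord0 then 0%N else k.+1)).
by move=> v /=; rewrite !mxE.
Qed.

Lemma definable_fun_cst (T : Type) (M : structure T) (c : T) :
  definable_fun M (fun=> c).
Proof.
exact: (definable_env_rename (fun i => if i is k.+1 then inr c else inl 0%N)
  (definable_fun_var M 0%N)).
Qed.

Lemma definable_env_eq (T : Type) (M : structure T) (s t : (nat -> T) -> T) :
  definable_fun M s -> definable_fun M t ->
  definable_env M (fun v => s v = t v).
Proof.
move=> ds dt; apply: (definable_env_subst2 (Q := fun x y _ => x = y) ds dt).
exact: definable_fun_var.
Qed.

Section OrderedVectorSpaceExpansion.
Context (R : realType) (K : {pred R}) (M : structure R).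
Context (M_expansion : expansion_of (ordered_vector_space K) M).

Lemma definable_env_lt (s t : (nat -> R) -> R) :
  definable_fun M s -> definable_fun M t ->
  definable_env M (fun v => s v < t v).
Proof.
move=> ds dt; apply: (definable_env_subst2 (Q := fun x y _ => x < y) ds dt).
have [F [P [_ _ _ hP]]] := M_expansion.
exists 2%N, (Rel (P 2%N LtSymb) (fun i => Var M i)), (fun i => inl (val i)).
by move=> v; rewrite /= hP /= !mxE.
Qed.

Lemma definable_env_le (s t : (nat -> R) -> R) :
  definable_fun M s -> definable_fun M t ->
  definable_env M (fun v => s v <= t v).
Proof.
move=> ds dt; apply: (@definable_env_ext _ _ (fun v => ~ t v < s v)).
  by move=> v; rewrite leNgt; split=> /negP.
by apply: definable_env_not; apply: definable_env_lt.
Qed.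

Lemma definable_fun_add (s t : (nat -> R) -> R) :
  definable_fun M s -> definable_fun M t ->
  definable_fun M (fun v => s v + t v).
Proof.
move=> ds dt; apply: (definable_env_subst2
  (Q := fun x y v => v 0%N = x + y) (definable_fun_shift ds)
  (definable_fun_shift dt)).
have [F [P [_ _ hF _]]] := M_expansion.
exists 3%N, (Equal (Var M ord_max)
  (App (F 2%N (AddSymb K)) (fun i => Var M (lift ord_max i)))),
  (fun i => inl (val i)).
by move=> v; rewrite /= hF /= !mxE.
Qed.

Lemma definable_fun_scale (c : R) (t : (nat -> R) -> R) :
  c \in K -> definable_fun M t -> definable_fun M (fun v => c * t v).
Proof.
move=> Kc dt; apply: (definable_env_subst
  (Q := fun x v => v 0%N = c * x) (definable_fun_shift dt)).
have [F [P [_ _ hF _]]] := M_expansion.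
exists 2%N, (Equal (Var M ord_max) (App (F 1%N (ScaleSymb Kc)) (fun=> Var M ord0))),
  (fun i => inl (val i)).
by move=> v; rewrite /= hF /= !mxE.
Qed.

Lemma definable_fun_sum (n : nat) (t : 'I_n -> (nat -> R) -> R) :
  (forall i, definable_fun M (t i)) ->
  definable_fun M (fun v => \sum_(i < n) t i v).
Proof.
elim: n t => [|n IH] t dt.
  rewrite (_ : (fun _ => _) = fun=> 0); first exact: definable_fun_cst.
  by apply/funext => v; rewrite big_ord0.
rewrite (_ : (fun _ => _) =
  fun v => t ord0 v + \sum_(i < n) t (lift ord0 i) v).
  by apply: definable_fun_add => //; apply: IH.
by apply/funext => v; rewrite big_ord_recl.
Qed.

Lemma definable_fun_row (n : nat) (t : 'I_n -> (nat -> R) -> R) (i : 'I_n) :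
  definable_fun M (t i) -> definable_fun M (fun v => (\row_j t j v) ord0 i).
Proof. by congr definable_fun; apply/funext => v; rewrite mxE. Qed.

End OrderedVectorSpaceExpansion.

(** * Coding a sequence of dense sets by two reals *)

(** The times at which the enumeration [f] comes closer to [c] from below than
    ever before; the bound [a] cuts off an uncontrolled initial part. *)
Definition record_times (R : realType) (f : nat -> R) (a c : R) : set nat :=
  [set t | a < f t < c /\ forall s, (s < t)%N -> ~ (f t < f s < c)].

Definition best_below (R : realType) (E : set R) (c e : R) : Prop :=
  [/\ E e, e < c & forall e', E e' -> e' < c -> e' <= e].

Lemma finite_gap_right (R : realType) (E : set R) (e M : R) :
  finite_set E -> e < M ->
  exists2 M', e < M' < M & forall x, E x -> ~ (e < x <= M').
Proof.
move=> finE eM.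
have [s sE] : exists s : seq R, forall x, E x -> x \in s.
  by move: finE => /finite_seqP[s ->]; exists s.
elim: s E {finE} sE => [|y s IH] E sE.
  exists ((e + M) / 2); first by rewrite midf_lt//= midf_lt.
  by move=> x /sE.
have [M1 /andP[eM1 M1M] hM1] := IH [set x | E x /\ x != y] (fun x =>
  ltac:(by move=> -[/sE]; rewrite inE => /orP[/eqP->|//]; rewrite eqxx)).
have [ey|ye] := ltP e y; last first.
  exists M1; first by rewrite eM1.
  move=> x Ex /andP[ex xM1]; apply: (hM1 x); last by rewrite ex.
  by split=> //; apply/eqP => xy; move: ex; rewrite xy ltNge ye.
have m : e < Num.min M1 ((e + y) / 2) by rewrite lt_min eM1 midf_lt.
exists (Num.min M1 ((e + y) / 2)); first by rewrite m gt_min M1M.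
move=> x Ex /andP[ex]; rewrite le_min => /andP[xM1 xm].
have [xy|xy] := eqVneq x y; last by apply: (hM1 x) => //; rewrite ex.
by move: xm; rewrite xy leNgt midf_lt.
Qed.

(** A step of the construction of the two reals: the clock window confines the
    real that determines the record times, the code window the real that is
    approximated at these times. *)
Record windows (R : realType) := Windows {
  clock_lo : R; clock_hi : R; code_lo : R; code_hi : R }.

(** What shrinking the windows from [w] to [w'] achieves at the record time [t].
    The code window starts at the element of [P] that is then the best
    approximation.  No earlier value of [f] lies between the old and the new
    clock windows' lower ends, nor in the new clock window: this makes [t] a
    record time, and the only one whose value exceeds the old lower end without
    exceeding the new one. *)
Definition refines (R : realType) (f : nat -> R) (E : nat -> set R) (P : set R)
    (w w' : windows R) (t : nat) : Prop :=
  [/\ [/\ clock_lo w < clock_lo w', clock_lo w' < clock_hi w' &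
          clock_hi w' < clock_hi w],
      [/\ code_lo w < code_lo w', code_lo w' < code_hi w' &
          code_hi w' < code_hi w],
      clock_lo w' = f t,
      forall s, (s < t)%N -> ~ (clock_lo w < f s < clock_hi w') &
      [/\ E t (code_lo w'), P (code_lo w') &
          forall x, E t x -> ~ (code_lo w' < x < code_hi w')]].

(** The target [x] in [P] is chosen first and appears at some stage [T].  The clock
    window is then shortened until it is free of all values of [f] up to time [T],
    so that the next record time is late enough for [x] to be available. *)
Lemma refinement_exists (R : realType) (f : nat -> R) (E : nat -> set R)
    (P : set R) (w : windows R) :
  (forall t, finite_set (E t)) ->
  (forall s t, (s <= t)%N -> E s `<=` E t) ->
  (forall a b, clock_lo w <= a -> a < b -> b <= clock_hi w ->
    exists t, a < f t < b) ->
  (exists x t, [/\ P x, E t x & code_lo w < x < code_hi w]) ->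
  clock_lo w < clock_hi w ->
  exists w' t, refines f E P w w' t.
Proof.
move=> Efin Emono fdense [x [T [Px ETx /andP[wx xw]]]] wlt.
have [h /andP[wh hw] hfree] := @finite_gap_right R (f @` `I_T.+1) _ _
  (finite_image _ (finite_II _)) wlt.
have [t0 ht0] := fdense _ _ (lexx _) wh (ltW hw).
(* The first value of f in the shortened clock window is the next record. *)
pose p t := clock_lo w < f t < h.
have [t /andP[wt th] tmin] := ex_minnP (ex_intro p t0 ht0).
have Tt : (T <= t)%N.
  rewrite leqNgt; apply/negP => tT; apply: (hfree (f t)); last by rewrite wt ltW.
  by exists t => //=; apply: leqW.
have [M' /andP[xM' M'w] M'free] := finite_gap_right (Efin t) xw.
exists (Windows (f t) ((f t + h) / 2) x M'), t; split => //=.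
- by rewrite midf_lt//; split=> //; rewrite (lt_trans _ hw)// midf_lt.
- move=> s st /andP[ws sh]; move: st; rewrite ltnNge => /negP; apply.
  by apply: tmin; rewrite /p ws (lt_trans sh)// midf_lt.
- split=> //; first exact: Emono Tt _ _.
  by move=> y Ey /andP[xy yM]; apply: (M'free y) => //; rewrite xy ltW.
Qed.

(** The limit is the supremum of the lower ends; strictness of the inequalities
    keeps it inside all the open intervals. *)
Lemma nested_limit (R : realType) (lo hi : nat -> R) :
  (forall n, lo n < lo n.+1) -> (forall n, hi n.+1 < hi n) ->
  (forall n, lo n < hi n) ->
  exists c, (forall n, lo n < c < hi n) /\
            (forall x, x < c -> exists n, x < lo n).
Proof.
move=> loS hiS lohi.
have lom : {homo lo : m n / (m <= n)%N >-> m <= n}.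
  exact: (@homo_leq R lo (fun x y => x <= y) (@lexx _ _)
    (fun y x z => @le_trans _ _ y x z) (fun n => ltW (loS n))).
have him : {homo hi : m n / (m <= n)%N >-> n <= m}.
  exact: (@homo_leq R hi (fun x y => y <= x) (@lexx _ _)
    (fun y x z xy yz => le_trans yz xy) (fun n => ltW (hiS n))).
have lh m n : lo m <= hi n.
  apply: le_trans (lom _ _ (leq_maxl m n)) _.
  exact: le_trans (ltW (lohi _)) (him _ _ (leq_maxr m n)).
have sup_lo : has_sup (range lo).
  by split; [exists (lo 0%N), 0%N|exists (hi 0%N) => _ [n _ <-]].
exists (sup (range lo)); split=> [n|x].
  apply/andP; split.
    by apply: lt_le_trans (loS n) _; apply: ub_le_sup; [case: sup_lo|exists n.+1].
  apply: le_lt_trans (hiS n); apply: ge_sup; first by case: sup_lo.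
  by move=> _ [m _ <-].
by move=> /(sup_gt (proj1 sup_lo))[_ [n _ <-]]; exists n.
Qed.

(** The sets [P j] are thought of as letters.  The letters read off at the record
    times of [d], through the best approximations of [c], are exactly the given
    ones. *)
Lemma coding (R : realType) (f : nat -> R) (E : nat -> set R)
    (P : nat -> set R) (a b p q : R) :
  injective f -> a < b -> p < q ->
  (forall x y, a <= x -> x < y -> y <= b -> exists t, x < f t < y) ->
  (forall t, finite_set (E t)) ->
  (forall s t, (s <= t)%N -> E s `<=` E t) ->
  (forall j x y, p <= x -> x < y -> y <= q ->
    exists e t, [/\ P j e, E t e & x < e < y]) ->
  exists c d : R,
    (forall t, record_times f a d t ->
      exists j, exists2 e, best_below (E t) c e & P j e) /\
    (forall j, exists2 t, record_times f a d t &
      exists2 e, best_below (E t) c e & P j e).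
Proof.
move=> finj ab pq fdense Efin Emono Pdense.
pose inv (w : windows R) := [/\ a <= clock_lo w, clock_lo w < clock_hi w &
  clock_hi w <= b] /\ [/\ p <= code_lo w, code_lo w < code_hi w & code_hi w <= q].
have step (jw : nat * windows R) : exists wt : windows R * nat,
    inv jw.2 -> refines f E (P jw.1) jw.2 wt.1 wt.2.
  case: jw => j w /=; have [iw|niw] := pselect (inv w); last first.
    by exists (w, 0%N) => /niw.
  have [[aw ww wb] [pw vw wq]] := iw.
  have [w' [t h]] : exists w' t, refines f E (P j) w w' t.
    apply: refinement_exists => //.
      by move=> x y wx xy yw; apply: fdense => //;
        [exact: le_trans wx|exact: le_trans yw _].
    by have [e [t [Pe Ee e_in]]] := Pdense j _ _ pw vw wq; exists e, t.
  by exists (w', t).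
have [next hnext] := choice step.
pose w := fix w n := if n is j.+1 then (next (j, w j)).1 else Windows a b p q.
pose t n := (next (n, w n)).2.
have winv n : inv (w n).
  elim: n => [|n IH]; first by split; split.
  have [[aw ww wb] [pw vw wq]] := IH.
  have [[h1 h2 h3] [h4 h5 h6] _ _ _] := hnext (n, w n) IH.
  split; split => //=; rewrite ?(le_trans aw) ?(le_trans pw) ?(ltW h1) ?(ltW h4)//.
    exact: le_trans (ltW h3) _.
  exact: le_trans (ltW h6) _.
have wS n : refines f E (P n) (w n) (w n.+1) (t n) by exact: (hnext (n, w n) (winv n)).
have [d [dw dlim]] := @nested_limit R (fun n => clock_lo (w n)) (fun n => clock_hi (w n))
  (fun n => ltac:(by case: (wS n) => -[]))
  (fun n => ltac:(by case: (wS n) => -[]))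
  (fun n => ltac:(by case: (winv n) => -[])).
have [c [cw _]] := @nested_limit R (fun n => code_lo (w n)) (fun n => code_hi (w n))
  (fun n => ltac:(by case: (wS n) => _ []))
  (fun n => ltac:(by case: (wS n) => _ []))
  (fun n => ltac:(by case: (winv n) => _ [])).
have best n : best_below (E (t n)) c (code_lo (w n.+1)).
  have [_ _ _ _ [Et _ free]] := wS n.
  have /andP[wc cw'] := cw n.+1.
  split=> // e Ee ec; rewrite leNgt; apply/negP => we.
  by apply: (free e) => //; rewrite we (lt_trans ec).
have rec n : record_times f a d (t n).
  have [[w1 w2 w3] _ wt free _] := wS n.
  have /andP[wd dw'] := dw n.+1.
  have [[aw _ _] _] := winv n.
  split; first by rewrite -wt wd (le_lt_trans aw).
  move=> s st /andP[ts sd]; apply: (free s st).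
  by rewrite (lt_trans w1) ?wt//= (lt_trans sd).
exists c, d; split=> [s [/andP[as_ sd] srec]|j]; last first.
  exists (t j) => //; exists (code_lo (w j.+1)) => //.
  by have [_ _ _ _ []] := wS j.
have [n0 sn0] := dlim _ sd.
pose above n := f s <= clock_lo (w n).
(* A record value f s lies in an interval ]clock_lo (w n), clock_lo (w n.+1)],
   and there the only record value is the right end. *)
have [[|n] sn nmin] := ex_minnP (ex_intro above n0 (ltW sn0)).
  by move: sn; rewrite /above /= leNgt as_.
have ns : clock_lo (w n) < f s.
  by rewrite ltNge; apply/negP => /nmin; rewrite ltnn.
have [[w1 w2 w3] _ wt free [_ Pn _]] := wS n.
have /andP[wd dw'] := dw n.+1.
suff -> : s = t n by exists n, (code_lo (w n.+1)).
apply: finj; rewrite -wt; apply: le_anti; rewrite [X in X && _]sn /= leNgt.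
apply/negP => sw.
have [st|] := ltnP s (t n).
  by apply: (free s st); rewrite ns (lt_trans sd).
rewrite leq_eqVlt => /orP[/eqP ts|ts]; first by rewrite wt ts ltxx in sw.
by apply: (srec _ ts); rewrite -wt sw.
Qed.

(** * A generic scalar *)

Lemma finite_set_roots (F : idomainType) (p : {poly F}) :
  p != 0 -> finite_set [set x | root p x].
Proof.
move=> p0; apply: contrapT => /(infinite_set_fset (size p))[B Bp].
rewrite leqNgt => /negP; apply; apply: max_poly_roots p0 _ (finmap.fset_uniq B).
by apply/allP => x xB; apply: (Bp x).
Qed.

(** For two fixed tuples the equality of the two combinations is a nonzero
    polynomial equation in [l]; there are countably many pairs of tuples, hence
    only countably many bad scalars. *)
Lemma generic_scalar (F : fieldType) (K : set F) (f : nat -> F) (n : nat) :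
  ~ countable K ->
  exists2 l, K l & forall z z' : 'rV[F]_n,
    (forall i, range f (z ord0 i)) -> (forall i, range f (z' ord0 i)) ->
    \sum_(i < n) l ^+ i * z ord0 i = \sum_(i < n) l ^+ i * z' ord0 i -> z = z'.
Proof.
move=> Kunc; apply: contrapT => nl; apply: Kunc.
pose S := ({ffun 'I_n -> nat} * {ffun 'I_n -> nat})%type.
pose d (s : S) : 'rV[F]_n := \row_i f (s.1 i) - \row_i f (s.2 i).
pose bad := \bigcup_(s in [set s : S | rVpoly (d s) != 0])
  [set x | root (rVpoly (d s)) x].
suff Kbad : K `<=` bad.
  apply: sub_countable (subset_card_le Kbad) _.
  apply: bigcup_countable; first exact: countableP.
  by move=> s /= /finite_set_roots /finite_set_countable.
move=> l Kl; apply: contrapT => lbad; apply: nl; exists l => // z z' zf z'f zz'.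
have idx (u : 'rV[F]_n) : (forall i, range f (u ord0 i)) ->
    exists s : {ffun 'I_n -> nat}, u = \row_i f (s i).
  move=> uf; have /choice[s hs] i : exists k, f k = u ord0 i.
    by have [k _ <-] := uf i; exists k.
  by exists [ffun i => s i]; apply/rowP => i; rewrite mxE ffunE hs.
have [s zs] := idx z zf; have [s' zs'] := idx z' z'f.
apply/eqP; rewrite -subr_eq0; apply/negPn/negP => dz.
apply: lbad; exists (s, s') => /=.
  rewrite /d /= -zs -zs'; apply: contra_neq dz => r0.
  by rewrite -[z - z']rVpolyK r0 linear0.
rewrite /d /= -zs -zs' linearB /= /root hornerD hornerN subr_eq0; apply/eqP.
have E (u : 'rV[F]_n) : (rVpoly u).[l] = \sum_(i < n) l ^+ i * u ord0 i.
  rewrite /rVpoly horner_poly; apply: eq_bigr => i _.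
  by rewrite valK mulrC.
by rewrite !E.
Qed.

(** The first coordinate, whose coefficient is 1, plays a special part below. *)
Lemma sum_row_cons (F : pzRingType) (n : nat) (l x : F) (y : 'rV[F]_n) :
  \sum_(i < n.+1) l ^+ i * row_mx (const_mx x : 'rV[F]_1) y ord0 i =
  x + \sum_(i < n) l ^+ i.+1 * y ord0 i.
Proof.
rewrite big_ord_recl expr0 mul1r row_consE unlift_none; congr (_ + _).
by apply: eq_bigr => i _; rewrite row_consE liftK lift0.
Qed.

(** * Arbitrary sets of tuples of a dense set of order type omega *)

(** The definable ordering, transported to indices. *)

Definition precedes (R : Type) (f : nat -> R) (u w : R) : Prop :=
  exists i j, [/\ u = f i, w = f j & (i < j)%N].

Definition up_to (R : Type) (f : nat -> R) (t : nat) : set R :=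
  [set f i | i in [set i | (i <= t)%N]].

Section DenseOmegaSequence.
Context (R : realType) (K : {pred R}) (M : structure R).
Context (K_subfield : GRing.divring_closed K).
Context (K_uncountable : ~ countable [set x : R | x \in K]).
Context (M_expansion : expansion_of (ordered_vector_space K) M).
Context (f : nat -> R) (p q : R) (f_inj : injective f) (pq : p < q).
Context (f_dense :
  forall x y, p <= x -> x < y -> y <= q -> exists t, x < f t < y).
Context (f_definable :
  definable_env M (fun v => precedes f (v 0%N) (v 1%N))).

Lemma subfield_exp (c : R) (n : nat) : c \in K -> c ^+ n \in K.
Proof.
have [K1 _ Kdiv] := K_subfield; move=> Kc.
elim: n => [|n IH]; first by rewrite expr0.
have -> : c ^+ n.+1 = c ^+ n / (1 / c) by rewrite mul1r invrK exprSr.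
exact: (Kdiv _ _ IH (Kdiv _ _ K1 Kc)).
Qed.

Lemma subfield_natV (n : nat) : n%:R^-1 \in K.
Proof.
have [K1 Ksub Kdiv] := K_subfield.
suff Kn : n%:R \in K by rewrite -[_^-1]mul1r; apply: Kdiv.
have K0 : 0 \in K by rewrite -(subrr 1); apply: Ksub.
elim: n => [//|n IH].
have -> : n.+1%:R = n%:R - (0 - 1) :> R by rewrite sub0r opprK natr1.
exact: (Ksub _ _ IH (Ksub _ _ K0 K1)).
Qed.

Lemma definable_env_precedes (s t : (nat -> R) -> R) :
  definable_fun M s -> definable_fun M t ->
  definable_env M (fun v => precedes f (s v) (t v)).
Proof.
move=> ds dt.
exact: (definable_env_subst2 (Q := fun x y _ => precedes f x y) ds dt).
Qed.

Lemma definable_env_range (s : (nat -> R) -> R) :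
  definable_fun M s -> definable_env M (fun v => range f (s v)).
Proof.
move=> ds; apply: (@definable_env_ext _ _
  (fun v => exists w, precedes f (s v) w)).
  move=> v; split=> [[w [i [j [-> _ _]]]]|[i _ <-]]; first by exists i.
  by exists (f i.+1), i, i.+1.
apply: definable_env_ex; apply: definable_env_precedes.
  exact: definable_fun_shift.
exact: definable_fun_var.
Qed.

(** The non-strict order, written so as to be definable from [precedes]. *)
Definition weakly_precedes (u w : R) : Prop :=
  [/\ range f u, range f w & ~ precedes f w u].

Lemma weakly_precedesP (u : R) (t : nat) :
  weakly_precedes u (f t) <-> up_to f t u.
Proof.
split=> [[[i _ <-] _ h]|[i /= it <-]].
  by exists i => //=; rewrite leqNgt; apply/negP => ti; apply: h; exists t, i.
split; [by exists i|by exists t|move=> [j [k [/f_inj tj /f_inj ik jk]]]].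
by move: jk; rewrite -tj -ik ltnNge it.
Qed.

Lemma definable_env_weakly_precedes (s t : (nat -> R) -> R) :
  definable_fun M s -> definable_fun M t ->
  definable_env M (fun v => weakly_precedes (s v) (t v)).
Proof.
move=> ds dt; apply: (@definable_env_ext _ _ (fun v =>
  range f (s v) /\ (range f (t v) /\ ~ precedes f (t v) (s v)))).
  by move=> v; split=> [[? []]|[]].
apply: definable_env_and; first exact: definable_env_range.
apply: definable_env_and; first exact: definable_env_range.
by apply: definable_env_not; apply: definable_env_precedes.
Qed.

(** The pairing of [x] with the tuple [y], injective on tuples over the range of
    [f] when [l] is generic. *)
Definition combination (k : nat) (l x : R) (y : 'rV[R]_k) : R :=
  x + \sum_(i < k) l ^+ i.+1 * y ord0 i.

Definition stage (k : nat) (l : R) (t : nat) : set R :=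
  [set e | exists x (y : 'rV[R]_k), [/\ up_to f t x,
    forall i, up_to f t (y ord0 i) & e = combination l x y]].

Lemma finite_stage (k : nat) (l : R) (t : nat) : finite_set (@stage k l t).
Proof.
pose g (s : 'I_t.+1 * {ffun 'I_k -> 'I_t.+1}) : R :=
  combination l (f s.1) (\row_i f (s.2 i)).
apply: (@sub_finite_set _ _ (range g)); last first.
  exact/finite_image/finite_finset.
move=> _ [x [y [[i it <-] yt ->]]].
have /choice[s hs] j : exists s : 'I_t.+1, f s = y ord0 j.
  by have [m mt <-] := yt j; exists (Ordinal (mt : (m < t.+1)%N)).
exists (Ordinal (it : (i < t.+1)%N), [ffun j => s j]) => //.
rewrite /g /=; congr combination.
by apply/rowP => j; rewrite mxE ffunE hs.
Qed.

(** For a fixed tuple the values of [combination] are a translate of the range of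
    [f].  When the tuples are confined to a small cube around the midpoint [m],
    each translation is within a quarter of the length of [p, q] of the one for
    the tuple (m, ..., m), so the translates are dense in one common interval. *)
Lemma combination_dense (k : nat) (l : R) : exists p' q' r s : R,
  [/\ p <= p', p' < q', q' <= q, r < s &
    forall (y : 'rV[R]_k) a b, (forall i, p' < y ord0 i < q') ->
    r <= a -> a < b -> b <= s -> exists t, a < combination l (f t) y < b].
Proof.
pose B := \sum_(i < k) `|l ^+ i.+1|.
have B0 : 0 <= B by apply: sumr_ge0.
pose m := (p + q) / 2; pose h := (q - p) / 2.
have h0 : 0 < h by rewrite divr_gt0 ?subr_gt0.
pose d := h / (2 * (B + 1)).
have d0 : 0 < d by rewrite divr_gt0// mulr_gt0// ltr_wpDl.
have hd : d * (2 * (B + 1)) = h by rewrite divfK// gt_eqF// mulr_gt0// ltr_wpDl.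
have dh : 2 * d <= h by rewrite -hd; nra.
have dB : 2 * (d * B) <= h by rewrite -hd; nra.
have mE : 2 * m = p + q by rewrite /m mulrC divfK.
have hE : 2 * h = q - p by rewrite /h mulrC divfK.
pose L := \sum_(i < k) l ^+ i.+1 * m.
exists (m - d), (m + d), (L + m - h / 2), (L + m + h / 2); split; try lra.
move=> y a b yd ra ab bs.
pose s := \sum_(i < k) l ^+ i.+1 * y ord0 i.
have sL : `|s - L| <= d * B.
  rewrite /s /L -sumrB (le_trans (ler_norm_sum _ _ _))// mulr_sumr ler_sum// => i _.
  rewrite -mulrBr normrM mulrC ler_wpM2r//.
  by have /andP[y1 y2] := yd i; rewrite ler_norml; apply/andP; split; lra.
move: sL; rewrite ler_norml => /andP[sL1 sL2].
have [| | |t /andP[t1 t2]] := @f_dense (a - s) (b - s); try lra.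
by exists t; rewrite /combination -/s; apply/andP; split; lra.
Qed.


Lemma definable_fun_combination (k : nat) (l : R) (x : (nat -> R) -> R)
    (y : (nat -> R) -> 'rV[R]_k) :
  l \in K -> definable_fun M x ->
  (forall i, definable_fun M (fun v => y v ord0 i)) ->
  definable_fun M (fun v => combination l (x v) (y v)).
Proof.
move=> Kl dx dy; apply: (definable_fun_add M_expansion dx).
apply: (definable_fun_sum M_expansion (t := fun i v => l ^+ i.+1 * y v ord0 i)).
by move=> i; apply: (definable_fun_scale M_expansion) => //; apply: subfield_exp.
Qed.

(** The conditions of [record_times], [stage] and [best_below], stated about
    elements of the range of [f] instead of indices so that they are definable. *)
Definition clock (d u : R) : Prop :=
  [/\ range f u, p < u, u < d &
      forall s, precedes f s u -> ~ (u < s /\ s < d)].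

Lemma clockP (d : R) (t : nat) : clock d (f t) <-> record_times f p d t.
Proof.
split=> [[_ pt td h]|[/andP[pt td] h]].
  split=> [|s st /andP[ts sd]]; first by rewrite pt.
  by apply: (h (f s)) => //; exists s, t.
split=> // _ [s [t' [-> /f_inj <- st]]] [ts sd].
by apply: (h s st); rewrite ts.
Qed.

Definition in_stage (k : nat) (l u e : R) : Prop :=
  exists x (y : 'rV[R]_k), [/\ weakly_precedes x u,
    forall i, weakly_precedes (y ord0 i) u & e = combination l x y].

Lemma in_stageP (k : nat) (l e : R) (t : nat) :
  in_stage k l (f t) e <-> stage k l t e.
Proof.
split=> -[x [y [hx hy ->]]]; exists x, y; split=> // [|i];
  exact/weakly_precedesP.
Qed.

Definition decoded (k : nat) (l c d : R) (y : 'rV[R]_k) : Prop :=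
  exists x u, [/\ clock d u, weakly_precedes x u,
    forall i, weakly_precedes (y ord0 i) u, combination l x y < c &
    forall e, in_stage k l u e -> e < c -> e <= combination l x y].

Lemma definable_env_clock (d : R) (u : (nat -> R) -> R) :
  definable_fun M u -> definable_env M (fun v => clock d (u v)).
Proof.
move=> du.
apply: (definable_env_subst (Q := fun u _ => clock d u) du).
apply: (@definable_env_ext _ _ (fun v => range f (v 0%N) /\ (p < v 0%N /\
  (v 0%N < d /\ forall s, precedes f s (v 0%N) -> ~ (v 0%N < s /\ s < d))))).
  by move=> v; split=> [[? [? []]]|[]].
apply: definable_env_and.
  by apply: definable_env_range; apply: definable_fun_var.
apply: definable_env_and.
  by apply: (definable_env_lt M_expansion);
    [exact: definable_fun_cst|exact: definable_fun_var].
apply: definable_env_and.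
  by apply: (definable_env_lt M_expansion);
    [exact: definable_fun_var|exact: definable_fun_cst].
apply: definable_env_all; apply: definable_env_imply.
  by apply: definable_env_precedes; apply: definable_fun_var.
apply: definable_env_not; apply: definable_env_and;
  apply: (definable_env_lt M_expansion);
  by [exact: definable_fun_var|exact: definable_fun_cst].
Qed.

Lemma definable_env_in_stage (k : nat) (l : R) :
  l \in K -> definable_env M (fun v => in_stage k l (v 0%N) (v 1%N)).
Proof.
move=> Kl; apply: definable_env_ex; apply: definable_env_ex_row.
apply: (@definable_env_ext _ _ (fun v =>
  weakly_precedes (v (k + 0)%N) (v (k + 1)%N) /\
  ((forall i : 'I_k, weakly_precedes (v i) (v (k + 1)%N)) /\
  v (k + 2)%N = combination l (v (k + 0)%N) (\row_(i < k) v i)))).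
  move=> v; split=> [[h1 [h2 h3]]|[h1 h2 h3]].
    by split=> // i; rewrite mxE.
  by split=> //; split=> // i; have := h2 i; rewrite mxE.
apply: definable_env_and.
  by apply: definable_env_weakly_precedes; apply: definable_fun_var.
apply: definable_env_and.
  apply: definable_env_forall_ord => i.
  by apply: definable_env_weakly_precedes; apply: definable_fun_var.
apply: definable_env_eq; first exact: definable_fun_var.
apply: definable_fun_combination => // [|i]; first exact: definable_fun_var.
by apply: (definable_fun_row (t := fun i v => v i)); apply: definable_fun_var.
Qed.

Lemma definable_decoded (k : nat) (l c d : R) :
  l \in K -> definable M [set y : 'rV[R]_k | decoded l c d y].
Proof.
move=> Kl; apply: (definable_of_env 0); rewrite /mkset.
apply: (definable_env_ex (Q := fun x v => exists u, _)).
apply: (definable_env_ex (Q := fun u v => _)).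
have dcomb : definable_fun M
    (fun v => combination l (v 1%N) (\row_(i < k) v i.+2)).
  apply: definable_fun_combination => // [|i]; first exact: definable_fun_var.
  by apply: (definable_fun_row (t := fun i v => v i.+2)); apply: definable_fun_var.
apply: (@definable_env_ext _ _ (fun v => clock d (v 0%N) /\
  (weakly_precedes (v 1%N) (v 0%N) /\
  ((forall i : 'I_k, weakly_precedes (v i.+2) (v 0%N)) /\
  (combination l (v 1%N) (\row_(i < k) v i.+2) < c /\
  forall e, in_stage k l (v 0%N) e -> e < c ->
    e <= combination l (v 1%N) (\row_(i < k) v i.+2)))))).
  move=> v; split=> [[h1 [h2 [h3 [h4 h5]]]]|[h1 h2 h3 h4 h5]].
    by split=> // i; rewrite mxE.
  do 2!split=> //; split=> //; first by move=> i; have := h3 i; rewrite mxE.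
apply: definable_env_and.
  by apply: definable_env_clock; apply: definable_fun_var.
apply: definable_env_and.
  by apply: definable_env_weakly_precedes; apply: definable_fun_var.
apply: definable_env_and.
  apply: definable_env_forall_ord => i.
  by apply: definable_env_weakly_precedes; apply: definable_fun_var.
apply: definable_env_and.
  by apply: (definable_env_lt M_expansion) => //; apply: definable_fun_cst.
apply: definable_env_all; apply: definable_env_imply.
  apply: (definable_env_subst2 (Q := fun u e _ => in_stage k l u e)).
  - exact: definable_fun_var.
  - exact: definable_fun_var.
  - exact: definable_env_in_stage.
apply: definable_env_imply.
  by apply: (definable_env_lt M_expansion);
    [exact: definable_fun_var|exact: definable_fun_cst].
apply: (definable_env_le M_expansion); first exact: definable_fun_var.
exact: (definable_fun_shift dcomb).
Qed.

(** Enumerate [X] as [g 0, g 1, ...] and let the letter [P j] be the set of the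
    combinations of elements of the range of [f] with [g j].  [coding] gives reals
    [c] and [d] from which [decoded] recovers the tuples [g j], because a
    combination determines its tuple. *)
Lemma definable_subset (k : nat) : exists p' q' : R,
  [/\ p <= p', p' < q', q' <= q & forall X : set 'rV[R]_k,
    (forall y i, X y -> range f (y ord0 i) /\ p' < y ord0 i < q') ->
    definable M X].
Proof.
have [l Kl linj] := @generic_scalar R [set x | x \in K] f k.+1 K_uncountable.
have comb_inj x x' (y y' : 'rV[R]_k) : range f x -> range f x' ->
    (forall i, range f (y ord0 i)) -> (forall i, range f (y' ord0 i)) ->
    combination l x y = combination l x' y' -> y = y'.
  move=> fx fx' fy fy'; rewrite /combination -!sum_row_cons => /linj h.
  have ranges z (u : 'rV[R]_k) : range f z -> (forall i, range f (u ord0 i)) ->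
      forall i, range f (row_mx (const_mx z : 'rV[R]_1) u ord0 i).
    by move=> fz fu i; rewrite row_consE; case: unlift.
  have /(congr1 (@rsubmx R 1 1 k)) := h (ranges _ _ fx fy) (ranges _ _ fx' fy').
  by rewrite !row_mxKr.
have [p' [q' [r [s [pp' p'q' q'q rs dense]]]]] := combination_dense k l.
exists p', q'; split=> // X Xsub.
have [[y0 Xy0]|X0] := pselect (X !=set0); last first.
  apply: (definable_of_env 0).
  apply: (definable_env_ext _ (definable_env_not (definable_env_true M))) => v.
  by split=> // Xv; case: X0; eexists; exact: Xv.
(* Codes that do not represent an element of X are sent to y0. *)
pose g j : 'rV[R]_k :=
  if unpickle j is Some s then
    if pselect (X (\row_i f ((s : {ffun 'I_k -> nat}) i)))
    then \row_i f (s i) else y0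
  else y0.
have gX j : X (g j).
  by rewrite /g; case: unpickle => // s'; case: pselect.
have Xg y : X y -> exists j, y = g j.
  move=> Xy; have /choice[m hm] i : exists n, f n = y ord0 i.
    by have [[n _ <-] _] := Xsub _ i Xy; exists n.
  have yE : y = \row_i f ([ffun i => m i] i).
    by apply/rowP => i; rewrite mxE ffunE hm.
  exists (pickle [ffun i => m i]); rewrite /g pickleK -yE.
  by case: pselect.
pose P j : set R := [set e | exists n, e = combination l (f n) (g j)].
have Emono t t' : (t <= t')%N -> stage k l t `<=` stage k l t'.
  move=> tt' _ [x [y [[i it <-] hy ->]]]; exists (f i), y; split=> // [|j].
    by exists i => //; exact: leq_trans tt'.
  by have [n nt <-] := hy j; exists n => //; exact: leq_trans tt'.
have Pdense j x y : r <= x -> x < y -> y <= s ->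
    exists e t, [/\ P j e, stage k l t e & x < e < y].
  move=> rx xy ys.
  have [n hn] := dense (g j) x y (fun i => proj2 (Xsub _ i (gX j))) rx xy ys.
  have /choice[m hm] i : exists n, f n = g j ord0 i.
    by have [[a _ <-] _] := Xsub _ i (gX j); exists a.
  exists (combination l (f n) (g j)), (n + \sum_i m i)%N; split=> //.
    by exists n.
  exists (f n), (g j); split=> // [|i]; first by exists n => //=; apply: leq_addr.
  exists (m i) => //=; rewrite (bigD1 i)//=.
  by rewrite addnCA; apply: leq_addr.
have [c [d [hclock hP]]] := coding f_inj pq rs f_dense
  (finite_stage k l) Emono Pdense.
suff -> : X = [set y | decoded l c d y] by apply: definable_decoded.
apply/seteqP; split => y /=.
  move=> /Xg[j ->]; have [t trec [e [est ec emax] [n eE]]] := hP j.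
  have [x [y' [hx hy' eE']]] := est.
  have gy' : g j = y'.
    apply: (@comb_inj (f n) x); rewrite -?eE -?eE'//.
    - by case: hx => a _ <-; exists a.
    - by move=> i; case: (Xsub _ i (gX j)).
    - by move=> i; case: (hy' i) => a _ <-; exists a.
  exists x, (f t); split.
  - exact/clockP.
  - exact/weakly_precedesP.
  - by move=> i; apply/weakly_precedesP; rewrite gy'.
  - by rewrite gy' -eE'.
  - by move=> e' /in_stageP; rewrite gy' -eE'; exact: emax.
move=> [x [u [hu]]]; have [[t _ tu] _ _ _] := hu; rewrite -{}tu in hu *.
move=> hx hy lc lmax.
have /clockP/hclock[j [e [est ec emax] [n eE]]] := hu.
suff -> : y = g j by exact: gX.
apply: (@comb_inj x (f n)) => //.
- by case: hx.
- by move=> i; case: (hy i).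
- by move=> i; case: (Xsub _ i (gX j)).
rewrite -eE; apply/eqP; rewrite eq_le; apply/andP; split.
  by apply: emax => //; apply/in_stageP; exists x, y.
by apply: lmax => //; apply/in_stageP.
Qed.

(** The entries of [y] other than the first code the centre of a ball, the first
    one the radius, as its excess over [m].  The map a |-> m + s a moves the
    compact set into the small cube in which the tuples range. *)
Definition in_coded_ball (n : nat) (m s : R) (y : 'rV[R]_n.+1) (a : 'rV[R]_n) : Prop :=
  forall i, `|m + s * a ord0 i - y ord0 (lift ord0 i)| < y ord0 ord0 - m.

(** The set is the complement, in a cube, of the union of the coded balls whose
    preimages avoid it: closedness and density of the range of [f] give such a
    ball around the image of each point of the complement. *)
Lemma definable_compact (n : nat) (A : set 'rV[R]_n) :
  compact A -> definable M A.
Proof.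
move=> cA.
have [B A_B] : exists B : R, forall (a : 'rV[R]_n) i, A a -> `|a ord0 i| <= B.
  have [b [_ /(_ (b + 1))]] := compact_bounded cA.
  rewrite ltrDl ltr01 => /(_ isT) hb; exists (b + 1) => a i /hb.
  apply: le_trans; rewrite [leRHS]mx_normrE.
  exact: (le_bigmax _ (fun ij => `|a ij.1 ij.2|) (ord0, i)).
have [p' [q' [pp' p'q' q'q sub]]] := definable_subset n.+1.
pose m := (p' + q') / 2; pose h := (q' - p') / 2.
have mE : 2 * m = p' + q' by rewrite /m mulrC divfK.
have hE : 2 * h = q' - p' by rewrite /h mulrC divfK.
have h0 : 0 < h by lra.
pose N := Num.bound `|2 * B / h|; pose s : R := N.+1%:R^-1.
have Ks : s \in K := subfield_natV N.+1.
have s0 : 0 < s by rewrite invr_gt0.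
have sB : 2 * (s * B) < h.
  have : 2 * B / h < N.+1%:R.
    rewrite (le_lt_trans (ler_norm _))// (lt_trans (archi_boundP (normr_ge0 _)))//.
    by rewrite ltr_nat.
  rewrite ltr_pdivrMr// -(ltr_pM2l s0) [X in _ < X]mulrA mulVf ?pnatr_eq0//.
  by rewrite mul1r mulrCA.
pose Y := [set y : 'rV[R]_n.+1 |
  (forall i, range f (y ord0 i) /\ p' < y ord0 i < q') /\
  forall a : 'rV[R]_n, in_coded_ball m s y a -> ~ A a].
have dY : definable M Y by apply: sub => y i -[].
have -> : A = [set a : 'rV[R]_n | (forall i, - B <= a ord0 i /\ a ord0 i <= B) /\
    forall y, Y y -> ~ in_coded_ball m s y a].
  apply/seteqP; split=> [a Aa|a [aB aY]] /=.
    split=> [i|y [_ hy] /hy//].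
    by have := A_B a i Aa; rewrite ler_norml => /andP.
  apply: contrapT => nAa.
  have /nbhs_ballP[e e0 ae] : nbhs a (~` A).
    apply: open_nbhs_nbhs; split=> //.
    by apply/closed_openC/(compact_closed (@norm_hausdorff _ _) cA).
  (* A radius at most r keeps all coordinates in ]p', q'[ and keeps the preimage of
   the ball, of diameter at most 2 r / s, inside the e-ball around a. *)
pose r := Num.min (s * e / 2) (h / 2).
  have r0 : 0 < r by rewrite lt_min; apply/andP; split; apply: divr_gt0 => //; apply: mulr_gt0.
  have rh : 2 * r <= h.
    have : r <= h / 2 by rewrite ge_min lexx orbT.
    by rewrite ler_pdivlMr// mulrC.
  have re : 2 * r <= s * e.
    have : r <= s * e / 2 by rewrite ge_min lexx.
    by rewrite ler_pdivlMr// mulrC.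
  have [|||t0 /andP[t1 t2]] := f_dense (x := m) (y := m + r); try lra.
  have saB i : `|s * a ord0 i| <= s * B.
    rewrite normrM gtr0_norm// ler_pM2l// ler_norml.
    by have [-> ->] := aB i.
  have /choice[t ht] i : exists t, m + s * a ord0 i - (f t0 - m) < f t <
      m + s * a ord0 i + (f t0 - m).
    have := saB i; rewrite ler_norml => /andP[h1 h2].
    by apply: f_dense; lra.
  pose y : 'rV[R]_n.+1 := row_mx (const_mx (f t0) : 'rV[R]_1) (\row_i f (t i)).
  have y0 : y ord0 ord0 = f t0 by rewrite row_consE unlift_none.
  have yS i : y ord0 (lift ord0 i) = f (t i) by rewrite row_consE liftK mxE.
  apply: (aY y).
    split=> [i|b hb]; last first.
      apply: ae; split; [exact: e0|move=> i j]; rewrite ord1 /ball /=.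
      have /andP[u1 u2] := ht j.
      have := hb j; rewrite yS y0 => /ltr_normlP[u3 u4].
      have : s * `|a ord0 j - b ord0 j| < s * e.
        by rewrite -[X in X * _](gtr0_norm s0) -normrM ltr_norml mulrBr; lra.
      by rewrite ltr_pM2l.
    case: (unliftP ord0 i) => [j|] ->; rewrite ?yS ?y0; split=> //.
      have := ht j; have := saB j; rewrite ler_norml => /andP[h1 h2] /andP[h3 h4].
      by lra.
    by lra.
  move=> i; rewrite yS y0 ltr_norml; have := ht i; lra.
apply: (definable_of_env 0); rewrite /mkset.
apply: (@definable_env_ext _ _ (fun v =>
  (forall i : 'I_n, - B <= v i /\ v i <= B) /\
  forall y, Y y -> ~ forall i : 'I_n,
    (m + s * v i) + m < y ord0 ord0 + y ord0 (lift ord0 i) /\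
    y ord0 (lift ord0 i) + m < y ord0 ord0 + (m + s * v i))).
  move=> v; split=> -[h1 h2]; split=> [i|y Yy hy].
  - by have := h1 i; rewrite mxE.
  - apply: (h2 y Yy) => i; have := hy i; rewrite mxE ltr_norml; lra.
  - by have := h1 i; rewrite mxE.
  - by apply: (h2 y Yy) => i; have := hy i; rewrite mxE ltr_norml => /andP; lra.
apply: definable_env_and.
  apply: definable_env_forall_ord => i; apply: definable_env_and;
    apply: (definable_env_le M_expansion);
    by [exact: definable_fun_var|exact: definable_fun_cst].
apply: definable_env_all_row; apply: definable_env_imply.
  exact: definable_env_row dY.
apply: definable_env_not; apply: definable_env_forall_ord => i.
have dy j : definable_fun M (fun v => (\row_(i < n.+1) v i) ord0 j).
  by apply: (definable_fun_row (t := fun j v => v j)); apply: definable_fun_var.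
have da : definable_fun M (fun v => m + s * v (n.+1 + i)%N).
  apply: (definable_fun_add M_expansion); first exact: definable_fun_cst.
  by apply: (definable_fun_scale M_expansion) => //; apply: definable_fun_var.
have add := definable_fun_add M_expansion.
have cst := definable_fun_cst M m.
by apply: definable_env_and; apply: (definable_env_lt M_expansion); apply: add.
Qed.
End DenseOmegaSequence.

(** * The two implications *)

Lemma dense_infinite (R : realType) (D : set R) (p q : R) :
  p < q -> (forall x y, p <= x -> x < y -> y <= q -> exists2 d, D d & x < d < y) ->
  infinite_set D.
Proof.
move=> pq dense finD.
have [z /andP[pz zq] free] := finite_gap_right finD pq.
have [d Dd /andP[pd dz]] := dense p z (lexx _) pz (ltW zq).
by apply: (free d Dd); rewrite pd ltW.
Qed.

Lemma dense_in_intervalP (R : realType) (D : set R) : dense_in_interval D ->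
  exists p q, p < q /\
    forall x y, p <= x -> x < y -> y <= q -> exists2 d, D d & x < d < y.
Proof.
move=> [I [_ Iopen [x0 Ix0] ID]].
have /nbhs_ballP[e /= e0 eI] : nbhs x0 I by apply: open_nbhs_nbhs.
exists (x0 - e / 2), (x0 + e / 2); split=> [|x y x0x xy yx0]; first by lra.
have Iz : I ((x + y) / 2) by apply: eI; rewrite /ball /= ltr_norml; lra.
have [z [[Dz _]]] := ID _ Iz _ (nbhsx_ballx _ ((y - x) / 2) ltac:(lra)).
by rewrite /ball /= ltr_norml => hz; exists z => //; lra.
Qed.

Lemma definable_compact_of_dense_omega (R : realType) (K : {pred R})
    (M : structure R) :
  GRing.divring_closed K -> ~ countable [set x : R | x \in K] ->
  expansion_of (ordered_vector_space K) M -> defines_dense_omega_orderable M ->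
  forall (n : nat) (A : set 'rV[R]_n), compact A -> definable M A.
Proof.
move=> Ksub Kunc MK [D [[defD fin_or_omega] /dense_in_intervalP[p [q [pq dense]]]]].
have Dinf := dense_infinite pq dense.
case: fin_or_omega => [finA|[lt [dlt [g [[gA ginj gsurj] glt]]]]].
  exfalso; apply: Dinf.
  have := finite_image (fun v : 'rV[R]_1 => v ord0 ord0) finA.
  by apply: sub_finite_set => x Dx; exists (const_mx x); rewrite /= mxE.
pose f n := g n ord0 ord0.
have gE n : g n = const_mx (f n).
  by apply/rowP => i; rewrite ord1 mxE.
have finj : injective f.
  move=> m n fmn; apply: ginj; rewrite ?inE//.
  by rewrite !gE fmn.
have Df n : D (f n) by apply: (gA n).
have fD x : D x -> exists n, f n = x.
  move=> Dx; have [|n _ gn] := gsurj (const_mx x); first by rewrite /= mxE.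
  by exists n; rewrite /f gn mxE.
have fdense x y : p <= x -> x < y -> y <= q -> exists t, x < f t < y.
  by move=> px xy yq; have [d /fD[t <-] h] := dense x y px xy yq; exists t.
have fdef : definable_env M (fun v => precedes f (v 0%N) (v 1%N)).
  apply: (definable_env_ext _ (definable_env_row (fun i => val i) dlt)) => v /=.
  set u := lsubmx _; set w := rsubmx _.
  have uE : u = const_mx (v 0%N) by apply/rowP => i; rewrite ord1 !mxE.
  have wE : w = const_mx (v 1%N) by apply/rowP => i; rewrite ord1 !mxE.
  rewrite {}uE {}wE !mxE; split=> [[/fD[i iE] /fD[j jE]]|[i [j [-> -> ij]]]].
    by rewrite -iE -jE -!gE => /glt ij; exists i, j.
  by split=> //; rewrite -!gE; apply/glt.
move=> n A; exact: (definable_compact Ksub Kunc MK finj pq fdense fdef).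
Qed.

Definition row2 (T : Type) (x y : T) : 'rV[T]_2 :=
  \row_i if i == ord0 then x else y.

(** The n-th point of the sequence is raised to height 1/(n+1): heights tell the
    points apart, and order them, while the limit points lie at height 0. *)
Definition flag (R : realType) (q : nat -> R) (n : nat) : 'rV[R]_2 :=
  row2 n.+1%:R^-1 (q n).

Lemma compact_closure_flag (R : realType) (q : nat -> R) :
  (forall n, 0 <= q n <= 1) -> compact (closure (range (flag q))).
Proof.
move=> q01.
have cube (a b : R) :
    compact [set v : 'rV[R]_2 | forall i, v ord0 i \in `[a, b]].
  apply: (@rV_compact _ _ (fun=> `[a, b]%classic)) => _.
  exact: segment_compact.
have cB := cube 0 1.
have clB := compact_closed (@norm_hausdorff _ _) cB.
apply: (subclosed_compact (@closed_closure _ _) cB).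
rewrite ((closure_id _).1 clB); apply: closureS => _ [n _ <-] i /=.
rewrite mxE in_itv /=; case: ifP => _ //.
by rewrite invr_ge0 ler0n invf_le1 ?ler1n.
Qed.

(** Above height [x / 2] there are only finitely many points of the sequence, so
    they do not accumulate at height [x]. *)
Lemma closure_flag_pos (R : realType) (q : nat -> R) (x y : R) : 0 < x ->
  closure (range (flag q)) (row2 x y) <->
  exists n, x = n.+1%:R^-1 /\ y = q n.
Proof.
move=> x0; split=> [cl|[n [-> ->]]]; last by apply: subset_closure; exists n.
have row2_inj (a b a' b' : R) : row2 a b = row2 a' b' -> a = a' /\ b = b'.
  by move=> /rowP e; have := e ord0; have := e ord_max; rewrite !mxE.
pose N := Num.bound `|2 / x|.
have Nx n : (N <= n)%N -> n.+1%:R^-1 < x / 2.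
  move=> Nn; rewrite invf_plt ?posrE ?ltr0n ?divr_gt0// invf_div.
  apply: le_lt_trans (ler_norm _) (lt_le_trans (archi_boundP (normr_ge0 _)) _).
  by rewrite ler_nat leqW.
apply: contrapT => nxy.
pose F := flag q @` `I_N.
have clF : closed F.
  apply: (accessible_finite_set_closed.1 _ F (finite_image _ (finite_II _))).
  exact: hausdorff_accessible (@norm_hausdorff _ _).
have nF : nbhs (row2 x y) (~` F).
  apply: open_nbhs_nbhs; split; first exact: closed_openC.
  by move=> [n _ /row2_inj[xn yn]]; apply: nxy; exists n.
have x20 : 0 < x / 2 by rewrite divr_gt0.
have := cl _ (filterI nF (nbhsx_ballx _ _ x20)).
move=> [_ [[n _ <-] [nFn [_ /(_ ord0 ord0)]]]].
rewrite !mxE /= /ball /= ltr_norml => h.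
have [nN|/Nx hn] := ltnP n N; first by apply: nFn; exists n.
by move: (n.+1%:R^-1) h hn => z; lra.
Qed.

Lemma dense_sequence (R : realType) : exists q : nat -> R,
  [/\ injective q, forall n, 0 < q n < 1 &
    forall x y : R, 0 <= x -> x < y -> y <= 1 -> exists n, x < q n < y].
Proof.
pose D : set R := ratr @` [set r : rat | 0 < (ratr r : R) < 1].
have dense x y : 0 <= x -> x < y -> y <= 1 -> exists2 d, D d & x < d < y.
  move=> x0 xy y1; have [r] := rat_in_itvoo xy; rewrite in_itv /= => xry.
  by exists (ratr r) => //; exists r => //=; lra.
have Dinf := dense_infinite ltr01 dense.
have Dcnt : countable D by exact: sub_countable (card_image_le _ _) _.
have /card_set_bijP[q [qD qinj qsurj]] : ([set: nat] #= D)%card.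
  by rewrite card_eq_sym; apply: eq_card_nat.
exists q; split=> [m n|n|x y x0 xy y1].
- by apply: qinj; rewrite inE.
- by have [r ? <-] := qD n I.
- by have [d /qsurj[n _ <-] h] := dense x y x0 xy y1; exists n.
Qed.

Lemma dense_omega_of_definable_compact (R : realType) (K : {pred R})
    (M : structure R) :
  expansion_of (ordered_vector_space K) M ->
  (forall (n : nat) (A : set 'rV[R]_n), compact A -> definable M A) ->
  defines_dense_omega_orderable M.
Proof.
move=> MK Mcompact.
have [q [qinj q01 qdense]] := dense_sequence R.
pose gr (x y : R) := exists n, x = n.+1%:R^-1 /\ y = q n.
have dgr s t : definable_fun M s -> definable_fun M t ->
    definable_env M (fun v => gr (s v) (t v)).
  move=> ds dt; apply: (definable_env_subst2 (Q := fun x y _ => gr x y) ds dt).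
  have cC : compact (closure (range (flag q))).
    by apply: compact_closure_flag => n; have := q01 n; lra.
  apply: (@definable_env_ext _ _ (fun v => 0 < v 0%N /\
      closure (range (flag q)) (\row_(i < 2) v i))).
    move=> v; have -> : \row_(i < 2) v i = row2 (v 0%N) (v 1%N).
      by apply/rowP => -[[|[|]]]//= h; rewrite !mxE.
    split=> [[v0]|]; first by move/(closure_flag_pos _ _ v0).
    move=> h; have v0 : 0 < v 0%N by have [n [-> _]] := h; rewrite invr_gt0.
    by split=> //; apply/closure_flag_pos.
  apply: definable_env_and; last exact: definable_env_row (Mcompact _ _ cC).
  by apply: (definable_env_lt MK);
    [exact: definable_fun_cst|exact: definable_fun_var].
pose lt (u w : 'rV[R]_1) := exists x x',
  [/\ gr x (u ord0 ord0), gr x' (w ord0 ord0) & x' < x].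
have var k := definable_fun_var M k.
exists (range q); split; last first.
  exists `]0, 1[%classic; split.
  - exact: interval_is_interval.
  - exact: interval_open.
  - by exists (1 / 2); rewrite /= in_itv /=; lra.
  - move=> x; rewrite /= in_itv /= => /andP[x0 x1] B /nbhs_ballP[e /= e0 eB].
    pose m := Num.min 1 (x + e).
    have m1 : m <= 1 by rewrite ge_min lexx.
    have me : m <= x + e by rewrite ge_min lexx orbT.
    have xm : x < m by rewrite lt_min x1 ltrDl.
    have [n /andP[n1 n2]] := qdense _ _ (ltW x0) xm m1.
    exists (q n); split; first by split; [exists n|rewrite /= in_itv /= q01].
    by apply: eB; rewrite /ball /= ltr_norml; lra.
split.
  apply: (definable_of_env 0).
  apply: (@definable_env_ext _ _ (fun v => exists x, gr x (v 0%N))).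
    move=> v /=; rewrite mxE; split=> [[x [n [_ ->]]]|[n _ <-]]; first by exists n.
    by exists n.+1%:R^-1, n.
  by apply: definable_env_ex; apply: dgr; apply: var.
right; exists lt; split.
  apply: (definable_of_env 0).
  apply: (@definable_env_ext _ _ (fun v => exists x x',
      gr x (v 0%N) /\ (gr x' (v 1%N) /\ x' < x))).
    move=> v /=; rewrite /lt !mxE /=; split.
      move=> [x [x' [h [h' xx']]]]; split.
      - by case: h => n [_ ->]; exists n.
      - by case: h' => n [_ ->]; exists n.
      - by exists x, x'.
    by move=> [_ _ [x [x' []]]]; exists x, x'.
  apply: definable_env_ex; apply: definable_env_ex.
  apply: definable_env_and; first by apply: dgr; apply: var.
  apply: definable_env_and; first by apply: dgr; apply: var.
  by apply: (definable_env_lt MK); apply: var.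
exists (fun n => const_mx (q n)); split.
  split=> [n _|m n _ _ /rowP/(_ ord0)|v [n _ qn]].
  - by rewrite /= mxE; exists n.
  - by rewrite !mxE => /qinj.
  - by exists n => //; apply/rowP => i; rewrite ord1 mxE.
move=> i j; split.
  move=> [x [x' []]]; rewrite !mxE => -[m [-> /qinj <-]] [n [-> /qinj <-]].
  by rewrite ltf_pV2 ?posrE ?ltr0n// ltr_nat.
move=> ij; exists i.+1%:R^-1, j.+1%:R^-1; rewrite !mxE; split.
- by exists i.
- by exists j.
- by rewrite ltf_pV2 ?posrE ?ltr0n// ltr_nat.
Qed.

Theorem theoremC (R : realType) (K : {pred R})
  (K_subfield : GRing.divring_closed K)
  (K_uncountable : ~ countable [set x : R | x \in K])
  (M : structure R)
  (M_expansion : expansion_of (ordered_vector_space K) M) :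
  ~ defines_dense_omega_orderable M <-> avoids_compact M.
Proof.
split=> [nomega|[n [A [cA nA]]] omega]; last first.
  exact: nA (definable_compact_of_dense_omega K_subfield K_uncountable
    M_expansion omega cA).
apply: contrapT => navoid; apply: nomega.
apply: (dense_omega_of_definable_compact M_expansion) => n A cA.
by apply: contrapT => nA; apply: navoid; exists n, A.
Qed.
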